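(* Let $(\mu_k)_{k=1}^\infty$ be a divergent, strictly increasing sequence of positive numbers such that the set $\mathcal S=\{\mu_k:k\in\mathbb N\}$ satisfies $x+y\in\mathcal S$ for all $x,y\in\mathcal S$ and $x+1\in\mathcal S$ for all $x\in\mathcal S$. Assume there is $T_f\ge 0$ such that $f$ is continuous on $[T_f,\infty)$, and that $$f(t)\sim\sum_{k=1}^\infty\frac{1}{t^{\mu_k}}\Big(\sum_{j=1}^{n_k}\frac{p_{k,j}(\ln\ln t)}{\ln^{\beta_{k,j}}(t)}\Big),$$ where $n_k\ge 1$ are integers, $\beta_{k,j}\ge 0$, and $p_{k,j}$ are polynomials from $\mathbb R$ to $\mathbb R^n$ for $1\le j\le n_k$. Let $T_0\ge 0$ and let $y\in C^1((T_0,\infty),\mathbb R^n)$ be a solution of $y'=-Ay+G(y)+f(t)$ on $(T_0,\infty)$ with $y(t)\to 0$ as $t\to\infty$. Then there exist natural numbers $J_k$, for $k\in\mathbb N$, $\mathbb R^n$-valued polynomials of one variable $q_{k,j}$ and non-negative numbers $\gamma_{k,j}$, for $1\le j\le J_k$, such that $$y(t)\sim\sum_{k=1}^\infty\frac{1}{t^{\mu_k}}\Big(\sum_{j=1}^{J_k}\frac{q_{k,j}(\ln\ln t)}{\ln^{\gamma_{k,j}}(t)}\Big).$$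
   Context: Notation: $\mathbb N=\{1,2,\ldots\}$, $|\cdot|$ is the Euclidean norm on $\mathbb R^n$, $n\in\mathbb N$ fixed, $\ln^\beta(t)=(\ln t)^\beta$, $\ln\ln t=\ln(\ln t)$. For functions of $t$, $g(t)=\mathcal O(h(t))$ means there are $T,C>0$ with $|g(t)|\le Ch(t)$ for all $t\ge T$. Standing assumptions on $y'=-Ay+G(y)+f(t)$ in $\mathbb R^n$: $A$ is a constant real $n\times n$ matrix which is diagonalizable with positive eigenvalues (i.e. $A=S^{-1}A_0S$ with $S$ invertible and $A_0$ diagonal with positive entries). $G:\mathbb R^n\to\mathbb R^n$ is locally Lipschitz, and there are functions $G_m:\mathbb R^n\to\mathbb R^n$, $m\ge 2$, each a homogeneous polynomial of degree $m$, such that for every $N\ge 2$ there exists $\delta>0$ with $|G(y)-\sum_{m=2}^NG_m(y)|=\mathcal O(|y|^{N+\delta})$ as $y\to 0$. The forcing $f$ is a function from $(0,\infty)$ to $\mathbb R^n$. Asymptotic expansion: $g(t)\sim\sum_{k=1}^\infty t^{-\mu_k}h_k(t)$, where each $h_k(t)$ is a finite sum of terms $p(\ln\ln t)(\ln t)^{-\beta}$ with $p:\mathbb R\to\mathbb R^n$ a polynomial and $\beta\in\mathbb R$, means that for each $N\in\mathbb N$ there is $\mu>\mu_N$ with $|g(t)-\sum_{k=1}^Nt^{-\mu_k}h_k(t)|=\mathcal O(t^{-\mu})$. *)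

(* Defs.v *)
From mathcomp Require Import all_boot all_order all_algebra.
From mathcomp Require mpoly.

Set Implicit Arguments.
Unset Strict Implicit.
Unset Printing Implicit Defensive.

(* The parsing rules of mpoly and of mathcomp-analysis are incompatible, so
   mpoly is only imported inside this module. *)
Module HomogeneousPolynomial.
Import mpoly GRing.Theory.
Local Open Scope ring_scope.

(* The zero map is homogeneous of every degree. *)
Definition homogeneous_poly_map (R : nzRingType) (n m : nat)
    (F : 'cV[R]_n -> 'cV[R]_n) : Prop :=
  exists P : 'I_n -> {mpoly R[n]},
    (forall i, P i \is m.-homog) /\
    (forall y i, F y i 0 = (P i).@[fun j => y j 0]).

End HomogeneousPolynomial.
Export HomogeneousPolynomial.

From mathcomp Require Import all_classical all_reals all_analysis.
Import Order.TTheory GRing.Theory Num.Theory.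
Import numFieldNormedType.Exports.

Local Open Scope classical_set_scope.
Local Open Scope ring_scope.

(* The library norm on 'cV[R]_n is the sup norm; it is used below only through
   notions that do not depend on the choice of a norm on R^n (continuity,
   limits, derivatives, local Lipschitz continuity). *)
Definition enorm (R : realType) (n : nat) (v : 'cV[R]_n) : R :=
  Num.sqrt (\sum_(i < n) (v i 0) ^+ 2).

Definition bigO_infty (R : realType) (n : nat) (g : R -> 'cV[R]_n)
    (h : R -> R) : Prop :=
  exists T C : R, [/\ 0 < T, 0 < C & forall t, T <= t -> enorm (g t) <= C * h t].

Definition bigO_zero (R : realType) (n : nat) (g : 'cV[R]_n -> 'cV[R]_n)
    (h : 'cV[R]_n -> R) : Prop :=
  exists r C : R,
    [/\ 0 < r, 0 < C & forall y, enorm y < r -> enorm (g y) <= C * h y].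

Definition diagonalizable_pos (R : realType) (n : nat) (A : 'M[R]_n) : Prop :=
  exists S : 'M[R]_n, exists d : 'rV[R]_n,
    [/\ S \in unitmx, forall i, 0 < d 0 i & A = invmx S *m diag_mx d *m S].

Definition locally_lipschitz (R : realType) (n : nat)
    (G : 'cV[R]_n -> 'cV[R]_n) : Prop :=
  forall x : 'cV[R]_n, exists2 U : set 'cV[R]_n, nbhs x U & [lipschitz G y | y in U].

Definition homogeneous_expansion (R : realType) (n : nat)
    (G : 'cV[R]_n -> 'cV[R]_n) (Gm : nat -> 'cV[R]_n -> 'cV[R]_n) : Prop :=
  (forall m, (2 <= m)%N -> homogeneous_poly_map m (Gm m)) /\
  (forall N, (2 <= N)%N -> exists2 delta : R, 0 < delta &
     bigO_zero (fun y => G y - \sum_(2 <= m < N.+1) Gm m y)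
               (fun y => enorm y `^ (N%:R + delta))).

(* A column of polynomials encodes a polynomial from R to R^n. *)
Definition vhorner (R : realType) (n : nat) (p : 'cV[{poly R}]_n) (x : R) :
    'cV[R]_n :=
  map_mx (fun q : {poly R} => q.[x]) p.

(* [ln t] is only a meaningful base of a real power for t > 1, and [ln (ln t)]
   is only meaningful there as well; this function is only used as t -> +oo. *)
Definition loglog_sum (R : realType) (n J : nat) (p : 'I_J -> 'cV[{poly R}]_n)
    (beta : 'I_J -> R) (t : R) : 'cV[R]_n :=
  \sum_(j < J) (ln t `^ beta j)^-1 *: vhorner (p j) (ln (ln t)).

(* Sequences are indexed from 0: [mu k] and [h k] are the exponent and the
   coefficient of rank k + 1, and the partial sum attached to [mu N] has
   N + 1 terms. *)
Definition asymptotic_expansion (R : realType) (n : nat) (g : R -> 'cV[R]_n)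
    (mu : nat -> R) (h : nat -> R -> 'cV[R]_n) : Prop :=
  forall N : nat, exists2 nu : R, mu N < nu &
    bigO_infty (fun t => g t - \sum_(k < N.+1) (t `^ mu k)^-1 *: h k t)
               (fun t => t `^ (- nu)).

Definition C1_solution (R : realType) (n : nat) (A : 'M[R]_n)
    (G : 'cV[R]_n -> 'cV[R]_n) (f : R -> 'cV[R]_n) (T0 : R)
    (y : R -> 'cV[R]_n) : Prop :=
  forall t, T0 < t ->
    [/\ derivable y t 1,
        {for t, continuous (derive1 y)} &
        derive1 y t = - (A *m y t) + G (y t) + f t].

(* Main.v *)
Require Import Defs.
From mathcomp Require Import all_boot all_order all_algebra.
From mathcomp Require mpoly polyrcf.
From mathcomp Require Import all_classical all_reals all_analysis.
From mathcomp Require Import ring lra.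
Import Order.TTheory GRing.Theory Num.Theory.
Import numFieldNormedType.Exports.

Set Implicit Arguments.
Unset Strict Implicit.
Unset Printing Implicit Defensive.

Local Open Scope classical_set_scope.
Local Open Scope ring_scope.

(** The solution is approximated to higher and higher powers of 1/t by finite
    sums of terms t^-a (ln t)^-g p(ln ln t) with a in the range of mu and g >= 0.
    The span of these terms is closed under products, because the exponents are
    closed under addition, and differentiation sends it into itself and raises
    the exponents by 1, because they are closed under x |-> x + 1.

    - Start. In coordinates w = S y that diagonalize A, the energy sum_i w_i^2
      satisfies a differential inequality in which the quadratic part of G is
      absorbed by the dissipation, since y tends to 0. Hence y = O(t^-s) for some
      s > 0 for which f = O(t^-s) ([solution_decays]).

    - Improvement. If y = Y + O(t^-r) with Y in the span, then every G_m having
      degree at least 2 gives G(y) = H + O(t^-(r+s)) with H in the span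
      ([nonlinearity_approx]). Each coordinate now solves a scalar equation
      w' = - d w + F + O(t^-(r+s)) with F in the span. Since F' is smaller than F
      by a factor 1/t, the truncated series F/d - F'/d^2 + F''/d^3 - ... is in the
      span and solves the equation up to an arbitrarily small residual
      ([formal_solution]); the difference between w and this series solves the
      linear equation with right-hand side O(t^-(r+s)), so it is O(t^-(r+s))
      itself ([stability]). This improves the order r to r + s ([refine_approx]),
      and iteration reaches every order.

    - Consistency. The approximations of different orders must share their
      coefficients. A finite sum of terms (ln t)^-g p(ln ln t) which is O(t^-e)
      for some e > 0 vanishes for large t, because its terms of least g dominate
      ([loglog_coef_eq0]). So the coefficient functions of an approximation are
      determined for large t, and the coefficient of rank k can be taken from the
      approximation of rank k ([expands_coherent]). *)

(** * Power decay at infinity *)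

Section Decay.
Variable R : realType.
Implicit Types (s t : R) (u v : R -> R).

Definition decays s u :=
  exists C : R, \forall t \near +oo, `|u t| <= C * t `^ (- s).

Lemma near_pinfty_gt s : \forall t \near +oo, s < t.
Proof. exact: nbhs_pinfty_gt (num_real s). Qed.

Lemma near_pinfty_ge s : \forall t \near +oo, s <= t.
Proof. exact: nbhs_pinfty_ge (num_real s). Qed.

Lemma near_pinftyP (P : R -> Prop) :
  (\forall t \near +oo, P t) <-> exists2 T : R, 0 < T & forall t, T <= t -> P t.
Proof.
split=> [[M [_ PM]]|[T T0 PT]].
  exists (`|M| + 1); first by rewrite ltr_wpDl.
  move=> t Mt; apply: PM; rewrite (lt_le_trans _ Mt)//.
  by rewrite (le_lt_trans (ler_norm M))// ltrDl.
by apply: filterS (near_pinfty_ge T).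
Qed.

Lemma near_pinfty_is_open (P : R -> Prop) :
  (\forall t \near +oo, P t) -> \forall t \near +oo, \forall x \near t, P x.
Proof.
move=> [M [M_real PM]]; exists M; split => // t Mt.
by near=> x; apply: PM; near: x; exact: lt_nbhsr.
Unshelve. all: by end_near. Qed.

Lemma decays_const s u : decays s u ->
  exists2 C : R, 0 < C & \forall t \near +oo, `|u t| <= C * t `^ (- s).
Proof.
move=> [C uC]; exists (`|C| + 1); first by rewrite ltr_wpDl.
apply: filterS uC => t /le_trans; apply.
by rewrite ler_wpM2r ?powR_ge0// (le_trans (ler_norm _))// lerDl.
Qed.

Lemma decays_eq s u v :
  (\forall t \near +oo, u t = v t) -> decays s u -> decays s v.
Proof.
move=> uv [C uC]; exists C; near=> t.
have <- : u t = v t by near: t.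
by near: t.
Unshelve. all: by end_near. Qed.

Lemma decays0 s : decays s (fun=> 0).
Proof. by exists 0; near=> t; rewrite normr0 mul0r. Unshelve. all: by end_near. Qed.

Lemma decays_powR s : decays s (fun t => t `^ (- s)).
Proof.
exists 1; near=> t; rewrite mul1r ger0_norm ?powR_ge0//.
Unshelve. all: by end_near. Qed.

Lemma decaysD s u v : decays s u -> decays s v -> decays s (fun t => u t + v t).
Proof.
move=> [C uC] [D vD]; exists (C + D); near=> t.
rewrite (le_trans (ler_normD _ _))// mulrDl lerD//; by near: t.
Unshelve. all: by end_near. Qed.

Lemma decaysZ s c u : decays s u -> decays s (fun t => c * u t).
Proof.
move=> [C uC]; exists (`|c| * C); near=> t.
rewrite normrM -mulrA ler_wpM2l//; by near: t.
Unshelve. all: by end_near. Qed.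

Lemma decaysN s u : decays s u -> decays s (fun t => - u t).
Proof.
move=> [C uC]; exists C; apply: filterS uC => t; by rewrite normrN.
Qed.

Lemma decaysB s u v : decays s u -> decays s v -> decays s (fun t => u t - v t).
Proof. by move=> us /decaysN vs; exact: decaysD us vs. Qed.

Lemma decays_sum (I : Type) (r : seq I) (P : pred I) s (u : I -> R -> R) :
  (forall i, P i -> decays s (u i)) -> decays s (fun t => \sum_(i <- r | P i) u i t).
Proof.
move=> us; elim: r => [|i r IHr].
  by under eq_fun do rewrite big_nil; exact: decays0.
case: (boolP (P i)) => Pi.
  under eq_fun do rewrite big_cons Pi; apply: decaysD => //; exact: us.
by under eq_fun do rewrite big_cons (negbTE Pi).
Qed.

Lemma decaysM s1 s2 u v :
  decays s1 u -> decays s2 v -> decays (s1 + s2) (fun t => u t * v t).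
Proof.
move=> [C uC] [D vD]; exists (C * D); near=> t.
rewrite opprD powRD; last by apply/implyP => _; rewrite gt_eqF//; near: t; exact: near_pinfty_gt.
rewrite mulrACA normrM ler_pM//; by near: t.
Unshelve. all: by end_near. Qed.

Lemma decays_weak s1 s2 u : s1 <= s2 -> decays s2 u -> decays s1 u.
Proof.
move=> s12 /decays_const[C C0 uC]; exists C; near=> t.
apply: (@le_trans _ _ (C * t `^ (- s2))); first by near: t.
rewrite ler_pM2l//; apply: ler_powR; last by rewrite lerN2.
near: t; exact: nbhs_pinfty_ge.
Unshelve. all: by end_near. Qed.

Lemma decays_vanish s u e : 0 < s -> decays s u -> 0 < e ->
  \forall t \near +oo, `|u t| <= e.
Proof.
move=> s0 /decays_const[C C0 uC] e0; near=> t.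
have t0 : 0 < t by near: t; exact: near_pinfty_gt.
apply: (@le_trans _ _ (C * t `^ (- s))); first by near: t.
rewrite powRN ler_pdivrMr ?powR_gt0// mulrC -ler_pdivrMr//.
have Ce0 : 0 <= C / e by rewrite divr_ge0// ltW.
rewrite -[leLHS]powRr1// -(@mulVf _ s) ?gt_eqF// powRrM.
apply: ge0_ler_powR; last by near: t; exact: nbhs_pinfty_ge.
- exact: ltW.
- by rewrite nnegrE powR_ge0.
- by rewrite nnegrE ltW.
Unshelve. all: by end_near. Qed.

End Decay.

(** * Logarithmic monomials *)

Section LogGrowth.
Variable R : realType.
Implicit Types (s t a g : R) (p : {poly R}) (u v : R -> R).

Lemma near_ln (P : R -> Prop) :
  (\forall x \near +oo, P x) -> \forall t \near +oo, P (ln t).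
Proof.
move=> [M [_ PM]]; exists (expR M); split; first exact: num_real.
move=> t Mt; apply: PM; rewrite -[M]expRK ltr_ln ?posrE ?expR_gt0//.
exact: lt_trans (expR_gt0 _) Mt.
Qed.

(** Polynomials are dominated by every growing exponential: at each degree the
    factor x is absorbed by half of the exponent, since y <= expR y. *)
Lemma poly_le_expR p e : 0 < e ->
  exists2 C : R, 0 < C & forall x, 0 <= x -> `|p.[x]| <= C * expR (e * x).
Proof.
elim/poly_ind: p e => [|p c IHp] e e0.
  by exists 1 => // x _; rewrite horner0 normr0 mul1r expR_ge0.
have e2 : 0 < e / 2 by rewrite divr_gt0.
have [C C0 pC] := IHp _ e2.
exists (C * (e / 2)^-1 + `|c|); first by rewrite ltr_pwDl// mulr_gt0 ?invr_gt0.
move=> x x0; rewrite hornerMXaddC (le_trans (ler_normD _ _))// mulrDl lerD//; last first.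
  by rewrite ler_peMr// -expR0 ler_expR mulr_ge0// ltW.
have -> : e * x = e / 2 * x + e / 2 * x by field.
rewrite expRD mulrACA normrM ler_pM//; first exact: pC.
rewrite ger0_norm// -ler_pdivrMl ?invr_gt0// invrK.
by rewrite (le_trans _ (expR_ge1Dx _))// lerDr.
Qed.

Lemma ln_le_powR t e : 0 < e -> 0 < t -> ln t <= e^-1 * t `^ e.
Proof.
move=> e0 t0; rewrite -ler_pdivrMl ?invr_gt0// invrK -ln_powR.
by rewrite ltW ?ln_sublinear ?powR_gt0.
Qed.

Definition loglog_term a g p t : R := t `^ (- a) * (ln t) `^ (- g) * p.[ln (ln t)].

(** The polynomial in ln ln t is O(ln t), hence smaller than every power of t; this
    is why s < a is strict. *)
Lemma decays_loglog_term a g p s : s < a -> 0 <= g -> decays s (loglog_term a g p).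
Proof.
move=> sa g0; have [C C0 pC] := poly_le_expR p (@ltr01 R).
have sa0 : 0 < a - s by rewrite subr_gt0.
exists (C * (a - s)^-1); near=> t.
have t0 : 0 < t by near: t; exact: near_pinfty_gt.
have lt1 : 1 <= ln t by near: t; exact: (near_ln (near_pinfty_ge 1)).
have lt0 : 0 < ln t by rewrite (lt_le_trans _ lt1).
rewrite /loglog_term !normrM !(ger0_norm (powR_ge0 _ _)).
have -> : t `^ (- s) = t `^ (- a + (a - s)) by congr (_ `^ _); ring.
rewrite [in leRHS]powRD ?(gt_eqF t0) ?implybT//.
rewrite -mulrA [leRHS]mulrCA ler_wpM2l ?powR_ge0//.
rewrite -[leRHS]mul1r ler_pM ?powR_ge0//.
  by rewrite powRN invf_le1 ?powR_gt0// -[leLHS](powRr0 (ln t)) ler_powR.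
rewrite (le_trans (pC _ _)) ?ln_ge0// mul1r lnK ?posrE//.
by rewrite -mulrA ler_pM2l// ln_le_powR.
Unshelve. all: by end_near. Qed.

Lemma loglog_termM a g p a' g' p' : \forall t \near +oo,
  loglog_term (a + a') (g + g') (p * p') t = loglog_term a g p t * loglog_term a' g' p' t.
Proof.
near=> t.
have t0 : 0 < t by near: t; exact: near_pinfty_gt.
have lt0 : 0 < ln t by near: t; exact: (near_ln (near_pinfty_gt 0)).
rewrite /loglog_term !opprD !powRD ?(gt_eqF t0) ?(gt_eqF lt0) ?implybT// hornerM.
by ring.
Unshelve. all: by end_near. Qed.

Lemma is_derive_loglog_term a g p : \forall t \near +oo,
  is_derive (t : R) 1 (loglog_term a g p)
   (loglog_term (a + 1) g (- a *: p) t + loglog_term (a + 1) (g + 1) (p^`() - g *: p) t).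
Proof.
near=> t.
have t0 : 0 < t by near: t; exact: near_pinfty_gt.
have lt0 : 0 < ln t by near: t; exact: (near_ln (near_pinfty_gt 0)).
have Dln := is_derive1_ln t0.
have D1 := is_derive1_powR (- a) t0.
have D2 := is_derive1_comp (is_derive1_powR (- g) lt0) Dln.
have D3 := @is_derive1_comp R (horner p) (@ln R \o @ln R) t _ _ (is_derive_poly p (ln (ln t)))
  (is_derive1_comp (is_derive1_ln lt0) Dln : is_derive t 1 (@ln R \o @ln R) _).
have D := is_deriveM (is_deriveM D1 D2) D3.
have tm c : t `^ (c - 1) = t `^ c * t^-1.
  by rewrite powRD ?(gt_eqF t0) ?implybT// powR_inv1 ?ltW.
have lm c : ln t `^ (c - 1) = ln t `^ c * (ln t)^-1.
  by rewrite powRD ?(gt_eqF lt0) ?implybT// powR_inv1 ?ltW.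
apply: (is_derive_eq (D : is_derive t 1 (loglog_term a g p) _)).
rewrite /loglog_term !fctE /= !opprD !tm !lm !hornerE /GRing.scale /=.
by ring.
Unshelve. all: by end_near. Qed.

End LogGrowth.

(** * Finite sums of logarithmic monomials *)

Section LoglogSpan.
Variables (R : realType) (S : set R).
Implicit Types (s t a g : R) (p : {poly R}) (u v : R -> R).

(** Only germs at infinity matter, so the span is closed under eventual
    equality. *)
Inductive loglog_span s : (R -> R) -> Prop :=
| LoglogSpan0 : loglog_span s (fun=> 0)
| LoglogSpanTerm a g p : S a -> s <= a -> 0 <= g -> loglog_span s (loglog_term a g p)
| LoglogSpanD u v : loglog_span s u -> loglog_span s v ->
    loglog_span s (fun t => u t + v t)
| LoglogSpanEq u v : (\forall t \near +oo, u t = v t) ->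
    loglog_span s u -> loglog_span s v.

Lemma loglog_spanZ s c u : loglog_span s u -> loglog_span s (fun t => c * u t).
Proof.
elim=> {u} [|a g p Sa sa g0|u v _ IHu _ IHv|u v uv _ IHu].
- by under eq_fun do rewrite mulr0; exact: LoglogSpan0.
- apply: (LoglogSpanEq _ (LoglogSpanTerm (c *: p) Sa sa g0)).
  by near=> t; rewrite /loglog_term hornerZ; ring.
- by under eq_fun do rewrite mulrDr; exact: LoglogSpanD.
- by apply: LoglogSpanEq IHu; apply: filterS uv => t ->.
Unshelve. all: by end_near. Qed.

Lemma loglog_span_sum (I : Type) (r : seq I) (P : pred I) s (u : I -> R -> R) :
  (forall i, P i -> loglog_span s (u i)) ->
  loglog_span s (fun t => \sum_(i <- r | P i) u i t).
Proof.
move=> us; elim: r => [|i r IHr].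
  by under eq_fun do rewrite big_nil; exact: LoglogSpan0.
case: (boolP (P i)) => Pi.
  under eq_fun do rewrite big_cons Pi; apply: LoglogSpanD => //; exact: us.
by under eq_fun do rewrite big_cons (negbTE Pi).
Qed.

Lemma loglog_span_weak s1 s2 u : s1 <= s2 -> loglog_span s2 u -> loglog_span s1 u.
Proof.
move=> s12; elim=> {u} [|a g p Sa sa g0|u v _ IHu _ IHv|u v uv _ IHu].
- exact: LoglogSpan0.
- by apply: LoglogSpanTerm => //; exact: le_trans sa.
- exact: LoglogSpanD.
- exact: LoglogSpanEq IHu.
Qed.

Lemma loglog_span_decays s1 s2 u : s1 < s2 -> loglog_span s2 u -> decays s1 u.
Proof.
move=> s12; elim=> {u} [|a g p Sa sa g0|u v _ IHu _ IHv|u v uv _ IHu].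
- exact: decays0.
- by apply: decays_loglog_term => //; exact: lt_le_trans sa.
- exact: decaysD.
- exact: decays_eq IHu.
Qed.

Lemma loglog_spanM s1 s2 u v : (forall a b, S a -> S b -> S (a + b)) ->
  loglog_span s1 u -> loglog_span s2 v -> loglog_span (s1 + s2) (fun t => u t * v t).
Proof.
move=> SD su sv; elim: su => {u} [|a g p Sa sa g0|u1 u2 _ IH1 _ IH2|u1 u2 u12 _ IH].
- by under eq_fun do rewrite mul0r; exact: LoglogSpan0.
- elim: sv => {v} [|a' g' p' Sa' sa' g'0|v1 v2 _ IH1 _ IH2|v1 v2 v12 _ IH].
  + by under eq_fun do rewrite mulr0; exact: LoglogSpan0.
  + apply: LoglogSpanEq (loglog_termM a g p a' g' p') _.
    by apply: LoglogSpanTerm; [exact: SD|exact: lerD|exact: addr_ge0].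
  + by under eq_fun do rewrite mulrDr; exact: LoglogSpanD.
  + by apply: LoglogSpanEq IH; apply: filterS v12 => t ->.
- by under eq_fun do rewrite mulrDl; exact: LoglogSpanD.
- by apply: LoglogSpanEq IH; apply: filterS u12 => t ->.
Qed.

(** Differentiation gains a factor t^-1: this is why exponents are closed under
    the shift by 1, and why derivatives are negligible against the function. *)
Lemma loglog_span_derive s u : (forall a, S a -> S (a + 1)) -> loglog_span s u ->
  exists2 du, loglog_span (s + 1) du & \forall t \near +oo, is_derive (t : R) 1 u (du t).
Proof.
move=> S1; elim=> {u} [|a g p Sa sa g0|u v _ [du sdu Du] _ [dv sdv Dv]|u v uv _ [du sdu Du]].
- by exists (fun=> 0); [exact: LoglogSpan0|near=> t; exact: is_derive_cst].
- exists (fun t => loglog_term (a + 1) g (- a *: p) t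
                 + loglog_term (a + 1) (g + 1) (p^`() - g *: p) t).
    by apply: LoglogSpanD; apply: LoglogSpanTerm; rewrite ?lerD2r ?addr_ge0//; exact: S1.
  exact: is_derive_loglog_term.
- exists (fun t => du t + dv t); first exact: LoglogSpanD.
  by near=> t; apply: is_deriveD; near: t.
- exists du => //; near=> t.
  apply: (@near_eq_is_derive _ _ _ u); last by near: t.
  by near: t; exact: near_pinfty_is_open uv.
Unshelve. all: by end_near. Qed.

(** Since F' is smaller than F by a factor 1/t, W = F / d solves W' = - d W + F up to
    the error F' / d; correcting this error in the same way M times leaves a residual
    smaller by t^-M. *)
Lemma formal_solution d s M F : d != 0 -> (forall a, S a -> S (a + 1)) ->
  loglog_span s F ->
  exists W : R -> R, loglog_span s W /\
  exists dW E : R -> R, [/\ loglog_span (s + M%:R) E,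
    \forall t \near +oo, is_derive (t : R) 1 W (dW t) &
    \forall t \near +oo, dW t = - d * W t + F t + E t].
Proof.
move=> d0 S1; elim: M s F => [|M IHM] s F sF.
  exists (fun=> 0); split; first exact: LoglogSpan0.
  exists (fun=> 0), (fun t => -1 * F t); rewrite addr0; split.
  - exact: loglog_spanZ.
  - by near=> t; exact: is_derive_cst.
  - by near=> t; rewrite mulr0 mulN1r add0r subrr.
have [dF sdF DF] := loglog_span_derive S1 sF.
have [W [sW [dW [E [sE DW eqW]]]]] := IHM _ _ (loglog_spanZ (- d^-1) sdF).
exists (fun t => d^-1 * F t + W t); split.
  apply: LoglogSpanD; first exact: loglog_spanZ.
  by apply: loglog_span_weak sW; rewrite lerDl.
exists (fun t => d^-1 * dF t + dW t), E; split.
- by rewrite -natr1 [M%:R + 1]addrC addrA.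
- near=> t; apply: is_deriveD; last by near: t.
  by apply: is_deriveZ; near: t.
- near=> t; have -> : dW t = - d * W t + - d^-1 * dF t + E t by near: t.
  by field.
Unshelve. all: by end_near. Qed.

End LoglogSpan.

(** * Stability of the scalar equation *)

Section Stability.
Variable R : realType.
Implicit Types (s t d : R) (z dz : R -> R).

Lemma is_derive_expRM d t : is_derive t 1 (fun x => expR (d * x)) (d * expR (d * t)).
Proof.
have Did : is_derive t 1 (fun x => d * x) d.
  have -> : (fun x => d * x) = d \*: @id R by [].
  by apply: is_derive_eq; last exact: mulr1.
rewrite mulrC; exact: (is_derive1_comp (is_derive_expR _) Did).
Qed.

(** K t^-s is a supersolution as soon as C <= d K / 2 and s / t <= d / 2, so
    expR (d t) (z - K t^-s) is nonincreasing from there on; K is taken large enough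
    for this function to start nonpositive. *)
Lemma upper_decay d s C z dz : 0 < d -> 0 <= s ->
  (\forall t \near +oo, is_derive (t : R) 1 z (dz t)) ->
  (\forall t \near +oo, dz t <= - d * z t + C * t `^ (- s)) ->
  exists K : R, \forall t \near +oo, z t <= K * t `^ (- s).
Proof.
move=> d0 s0 Dz zC.
have /near_pinftyP[T T0 HT] : \forall t \near +oo,
    [/\ is_derive (t : R) 1 z (dz t), dz t <= - d * z t + C * t `^ (- s)
      & 2 * s / d <= t].
  by near=> t; split; near: t => //; exact: near_pinfty_ge.
pose K : R := `|2 * C / d| + `|z T| * T `^ s.
have K0 : 0 <= K by rewrite addr_ge0 ?mulr_ge0 ?powR_ge0.
have CK : C - d * K / 2 <= 0.
  rewrite subr_le0 -ler_pdivrMr ?invr_gt0// invrK mulrC -[leRHS]mulrC -ler_pdivrMr//.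
  by rewrite (le_trans (ler_norm _))// lerDl mulr_ge0 ?powR_ge0.
pose phi t := expR (d * t) * (z t - K * t `^ (- s)).
pose dphi t := expR (d * t) * (dz t + d * z t - d * K * t `^ (- s) + K * s * (t `^ (- s) / t)).
have Dphi t : T <= t -> is_derive t 1 phi (dphi t).
  move=> Tt; have [Dz1 _ _] := HT _ Tt; have t0 := lt_le_trans T0 Tt.
  have De := is_derive_expRM d t.
  have Dp := is_derive1_powR (- s) t0.
  have D := is_deriveM De (is_deriveB Dz1 (is_deriveZ K Dp)).
  apply: (is_derive_eq (D : is_derive t 1 phi _)).
  rewrite /dphi !fctE /= /GRing.scale/= powRD ?(gt_eqF t0) ?implybT// powR_inv1 ?ltW//.
  by ring.
exists K; apply/near_pinftyP; exists T => // t Tt.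
have t0 := lt_le_trans T0 Tt.
have phi_le : phi t <= phi T.
  apply: (@ler0_derive1_nincry _ phi T) => // [x|x|].
  - by rewrite in_itv/= andbT => /ltW /Dphi [].
  - rewrite in_itv/= andbT => /ltW Tx; have x0 := lt_le_trans T0 Tx.
    have [_ zx sx] := HT _ Tx; have Dx := Dphi _ Tx.
    rewrite derive1E derive_val /dphi pmulr_rle0 ?expR_gt0//.
    apply: (@le_trans _ _ ((C - d * K + K * (s / x)) * x `^ (- s))).
      have -> : (C - d * K + K * (s / x)) * x `^ (- s) =
          C * x `^ (- s) - d * K * x `^ (- s) + K * s * (x `^ (- s) / x) by ring.
      lra.
    rewrite pmulr_lle0 ?powR_gt0// (le_trans _ CK)//.
    have : K * (s / x) <= K * (d / 2).
      rewrite ler_wpM2l// ler_pdivrMr// [leLHS](_ : s = d / 2 * (2 * s / d)).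
        by rewrite ler_wpM2l// divr_ge0// ltW.
      by field; rewrite gt_eqF.
    lra.
  - apply: derivable_within_continuous => x; rewrite in_itv/= andbT => Tx.
    by have [] := Dphi _ Tx.
have : phi t <= 0.
  rewrite (le_trans phi_le)// /phi pmulr_rle0 ?expR_gt0// subr_le0 powRN.
  rewrite ler_pdivlMr ?powR_gt0// (le_trans _ (_ : `|z T| * T `^ s <= _))// ?lerDr//.
  by rewrite ler_pM2r ?powR_gt0// ler_norm.
by rewrite /phi pmulr_rle0 ?expR_gt0// subr_le0.
Unshelve. all: by end_near. Qed.

Lemma stability d s z dz r : 0 < d -> 0 <= s ->
  (\forall t \near +oo, is_derive (t : R) 1 z (dz t)) ->
  (\forall t \near +oo, dz t = - d * z t + r t) ->
  decays s r -> decays s z.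
Proof.
move=> d0 s0 Dz eqz [C rC].
have [K1 zK1] : exists K : R, \forall t \near +oo, z t <= K * t `^ (- s).
  apply: (upper_decay (C := C) d0 s0 Dz); near=> t.
  have -> : dz t = - d * z t + r t by near: t.
  rewrite lerD2l (le_trans (ler_norm _))//; near: t; exact: rC.
have [K2 zK2] : exists K : R, \forall t \near +oo, - z t <= K * t `^ (- s).
  apply: (@upper_decay d s C (fun t => - z t) (fun t => - dz t)) => //.
    by near=> t; apply: is_deriveN; near: t.
  near=> t; have -> : dz t = - d * z t + r t by near: t.
  rewrite opprD mulrN lerD2l (le_trans (ler_norm _))// normrN; near: t; exact: rC.
exists (`|K1| + `|K2|); near=> t.
rewrite ler_norml lerNl; apply/andP; split.
  apply: (@le_trans _ _ (K2 * t `^ (- s))); first by near: t.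
  by rewrite ler_wpM2r ?powR_ge0// (le_trans (ler_norm _))// lerDr.
apply: (@le_trans _ _ (K1 * t `^ (- s))); first by near: t.
by rewrite ler_wpM2r ?powR_ge0// (le_trans (ler_norm _))// lerDl.
Unshelve. all: by end_near. Qed.

End Stability.

(** * Homogeneous polynomial functions *)

Section Homogeneous.
Variables (R : realType) (n : nat).
Implicit Types (F : 'cV[R]_n -> R) (m k : nat).

(** Homogeneous polynomial functions generated from the coordinates, without
    constants: this form makes every property below an induction on the way the
    function is built. *)
Inductive homfun : nat -> ('cV[R]_n -> R) -> Prop :=
| HomCoord i : homfun 1 (fun y => y i 0)
| Hom0 m : homfun m (fun=> 0)
| HomZ m c F : homfun m F -> homfun m (fun y => c * F y)
| HomD m F1 F2 : homfun m F1 -> homfun m F2 -> homfun m (fun y => F1 y + F2 y)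
| HomM m k F1 F2 : homfun m F1 -> homfun k F2 -> homfun (m + k) (fun y => F1 y * F2 y).

Lemma homfun_coord_exp i k : (0 < k)%N -> homfun k (fun y => y i 0 ^+ k).
Proof.
case: k => // k _; elim: k => [|k IHk].
  by under eq_fun do rewrite expr1; exact: HomCoord.
under eq_fun do rewrite exprS.
exact: (HomM (HomCoord i) IHk).
Qed.

(** The left alternative is the constant monomial, which [homfun] leaves out. *)
Lemma homfun_monomial (e : 'I_n -> nat) (r : seq 'I_n) :
  (\sum_(i <- r) e i = 0)%N /\ (forall y : 'cV[R]_n, \prod_(i <- r) y i 0 ^+ e i = 1)
  \/ homfun (\sum_(i <- r) e i) (fun y => \prod_(i <- r) y i 0 ^+ e i).
Proof.
elim: r => [|i r IHr].
  by left; rewrite big_nil; split => // y; rewrite big_nil.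
rewrite big_cons.
have -> : (fun y : 'cV[R]_n => \prod_(j <- i :: r) y j 0 ^+ e j) =
    fun y => y i 0 ^+ e i * \prod_(j <- r) y j 0 ^+ e j.
  by apply/funext => y; rewrite big_cons.
have [ei0|ei0] := posnP (e i); case: IHr => [[r0 r1]|IHr].
- by left; split=> [|y]; rewrite ?big_cons ei0 ?r0// r1 mul1r.
- by right; rewrite ei0 add0n; under [X in homfun _ X]eq_fun do rewrite expr0 mul1r.
- right; rewrite r0 addn0; under [X in homfun _ X]eq_fun do rewrite r1 mulr1.
  exact: homfun_coord_exp.
- by right; apply: HomM => //; exact: homfun_coord_exp.
Qed.

Lemma homogeneous_homfun m (F : 'cV[R]_n -> 'cV[R]_n) i : (0 < m)%N ->
  homogeneous_poly_map m F -> homfun m (fun y => F y i 0).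
Proof.
move=> m0 [P [homP eqP]]; under eq_fun do rewrite eqP mpoly.mevalE.
have /mpoly.dhomogP := homP i.
elim: (mpoly.msupp _) => [_|e r IHr degr].
  by under eq_fun do rewrite big_nil; exact: Hom0.
under eq_fun do rewrite big_cons; apply: HomD; last first.
  by apply: IHr => e' er; apply: degr; rewrite inE er orbT.
apply: HomZ.
have <- : mpoly.mdeg e = m by apply: degr; rewrite inE eqxx.
have := homfun_monomial (mpoly.fun_of_multinom e) (index_enum 'I_n).
rewrite -mpoly.mdegE => -[[e0 _]|//].
by move: m0; rewrite -(degr e) ?inE ?eqxx// [mpoly.Measure.sort _ _]e0.
Qed.

Lemma homfun_bound m F : homfun m F -> exists2 C : R, 0 <= C &
  forall (b : R) (y : 'cV[R]_n), 0 <= b -> (forall i, `|y i 0| <= b) -> `|F y| <= C * b ^+ m.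
Proof.
elim=> {m F} [i|m|m c F _ [C C0 FC]|m F G _ [C C0 FC] _ [D D0 GD]|m k F G _ [C C0 FC] _ [D D0 GD]].
- by exists 1 => // b y b0 yb; rewrite mul1r expr1.
- by exists 0 => // b y b0 yb; rewrite normr0 mul0r.
- exists (`|c| * C) => [|b y b0 yb]; first exact: mulr_ge0.
  by rewrite normrM -mulrA ler_wpM2l//; exact: FC.
- exists (C + D) => [|b y b0 yb]; first exact: addr_ge0.
  by rewrite (le_trans (ler_normD _ _))// mulrDl lerD//; [exact: FC|exact: GD].
- exists (C * D) => [|b y b0 yb]; first exact: mulr_ge0.
  by rewrite normrM exprD mulrACA ler_pM//; [exact: FC|exact: GD].
Qed.

Lemma homfun_loglog_span (S : set R) (Y : R -> 'cV[R]_n) m F :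
  (forall a b, S a -> S b -> S (a + b)) ->
  (forall i, loglog_span S 0 (fun t => Y t i 0)) ->
  homfun m F -> loglog_span S 0 (fun t => F (Y t)).
Proof.
move=> SD sY; elim=> {m F} [i|m|m c F _ sF|m F G _ sF _ sG|m k F G _ sF _ sG].
- exact: sY.
- exact: LoglogSpan0.
- exact: loglog_spanZ.
- exact: LoglogSpanD.
- by rewrite -[X in loglog_span _ X]addr0; exact: loglog_spanM.
Qed.

Lemma homfun_decays (y : R -> 'cV[R]_n) s m F :
  (forall i, decays s (fun t => y t i 0)) ->
  homfun m F -> decays (m%:R * s) (fun t => F (y t)).
Proof.
move=> sy; elim=> {m F} [i|m|m c F _ sF|m F G _ sF _ sG|m k F G _ sF _ sG].
- by rewrite mul1r; exact: sy.
- exact: decays0.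
- exact: decaysZ.
- exact: decaysD.
- by rewrite natrD mulrDl; exact: decaysM.
Qed.

(** In a product, the difference x x' - z z' = x (x' - z') + (x - z) z' replaces
    one factor of order s by a difference of order r. *)
Lemma homfun_diff_decays (y z : R -> 'cV[R]_n) s r m F :
  (forall i, decays s (fun t => y t i 0)) -> (forall i, decays s (fun t => z t i 0)) ->
  (forall i, decays r (fun t => y t i 0 - z t i 0)) ->
  homfun m F -> decays (r + (m%:R - 1) * s) (fun t => F (y t) - F (z t)).
Proof.
move=> sy sz ryz; elim=> {m F} [i|m|m c F _ sF|m F G _ sF _ sG|m k F G hF sF hG sG].
- by rewrite subrr mul0r addr0; exact: ryz.
- by under eq_fun do rewrite subrr; exact: decays0.
- by under eq_fun do rewrite -mulrBr; exact: decaysZ.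
- apply: decays_eq (decaysD sF sG); near=> t; ring.
- have dF := homfun_decays sy hF; have dG := homfun_decays sz hG.
  have -> : r + ((m + k)%:R - 1) * s = m%:R * s + (r + (k%:R - 1) * s).
    by rewrite natrD; ring.
  apply: decays_eq (decaysD (decaysM dF sG) _); last first.
    have -> : m%:R * s + (r + (k%:R - 1) * s) = r + (m%:R - 1) * s + k%:R * s by ring.
    exact: decaysM sF dG.
  near=> t; ring.
Unshelve. all: by end_near. Qed.

End Homogeneous.

(** * Uniqueness of the coefficients *)

Section Coefficients.
Variable R : realType.
Implicit Types (s t a g e : R) (p : {poly R}) (u v : R -> R) (l : seq (R * {poly R})).

Definition loglog_coef l t : R := \sum_(x <- l) loglog_term 0 x.1 x.2 t.

Lemma loglog_term0E g p t : loglog_term 0 g p t = ln t `^ (- g) * p.[ln (ln t)].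
Proof. by rewrite /loglog_term oppr0 powRr0 mul1r. Qed.

Lemma loglog_coef_cat l l' t : loglog_coef (l ++ l') t = loglog_coef l t + loglog_coef l' t.
Proof. exact: big_cat. Qed.

Lemma loglog_coef_opp l t :
  loglog_coef [seq (x.1, - x.2) | x <- l] t = - loglog_coef l t.
Proof.
rewrite /loglog_coef big_map -sumrN; apply: eq_bigr => x _.
by rewrite !loglog_term0E hornerN mulrN.
Qed.

(** Only the loss e < 0 is available: a coefficient may grow like a power of
    ln ln t. *)
Lemma loglog_coef_decays l e : all (fun x => 0 <= x.1) l -> e < 0 -> decays e (loglog_coef l).
Proof.
move=> /allP l0 e0; rewrite /loglog_coef; apply: loglog_span_decays e0 _.
rewrite (_ : (fun t => _) = fun t => \sum_(x <- l | x \in l) loglog_term 0 x.1 x.2 t).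
  by apply: (@loglog_span_sum _ setT) => x /l0 x0; exact: LoglogSpanTerm.
by apply/funext => t; rewrite -big_seq.
Qed.

Lemma poly_vanish_lnln p :
  (forall e, 0 < e -> \forall t \near +oo, `|p.[ln (ln t)]| <= e) -> p = 0.
Proof.
move=> p0; apply/eqP/negPn/negP => pN0.
wlog lp : p p0 pN0 / 0 < lead_coef p.
  move=> wl; have [|lp|lp] := ltgtP 0 (lead_coef p); first exact: wl.
    apply: (wl (- p)); rewrite ?oppr_eq0 ?lead_coefN ?oppr_gt0//.
    by move=> e /p0; apply: filterS => t; rewrite hornerN normrN.
  by move: pN0; rewrite -lead_coef_eq0 -lp eqxx.
have [M pM] := polyrcf.poly_pinfty_gt_lc lp.
have : \forall t \near +oo, ~ (1 < t :> R).
  have lp2 : 0 < lead_coef p / 2 by rewrite divr_gt0.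
  near=> t => _.
  have tM : M <= ln (ln t) by near: t; exact: near_ln (near_ln (near_pinfty_ge M)).
  have : `|p.[ln (ln t)]| <= lead_coef p / 2 by near: t; exact: p0.
  have := pM _ tM; rewrite real_ler_norml ?num_real//; lra.
move=> /near_pinftyP[T T0 HT]; apply: (HT (T + 1)); lra.
Unshelve. all: by end_near. Qed.

Lemma lnln_term_vanish g p e : 0 < g -> 0 < e ->
  \forall t \near +oo, `|loglog_term 0 g p t| <= e.
Proof.
move=> g0 e0; have g2 : 0 < g / 2 by rewrite divr_gt0.
have [C C0 pC] := poly_le_expR p g2.
have := near_ln (decays_vanish g2 (decaysZ C (decays_powR (g / 2))) e0).
move=> vanish; near=> t.
have lt1 : 1 <= ln t by near: t; exact: (near_ln (near_pinfty_ge 1)).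
have lt0 : 0 < ln t by rewrite (lt_le_trans _ lt1).
apply: (@le_trans _ _ `|C * ln t `^ (- (g / 2))|); last by near: t.
rewrite loglog_term0E !normrM !(ger0_norm (powR_ge0 _ _)) (gtr0_norm C0).
have -> : ln t `^ (- g) = ln t `^ (- (g / 2)) * ln t `^ (- (g / 2)).
  by rewrite -powRD ?(gt_eqF lt0) ?implybT//; congr (_ `^ _); field.
rewrite -mulrA [leRHS]mulrC ler_wpM2l ?powR_ge0//.
rewrite powRN -ler_pdivlMl ?invr_gt0 ?powR_gt0// invrK mulrC.
by rewrite (le_trans (pC _ _)) ?ln_ge0// /powR gt_eqF.
Unshelve. all: by end_near. Qed.

Lemma exists_min_exponent l : l != [::] ->
  exists2 x, x \in l & forall y, y \in l -> x.1 <= y.1.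
Proof.
elim: l => // x [|y l] IHl _.
  by exists x => [|z]; rewrite ?inE// => /eqP ->.
have [//|z zl zmin] := IHl; have [xz|zx] := leP x.1 z.1.
  exists x => [|w]; rewrite inE ?eqxx// => /predU1P[-> //|/zmin].
  exact: le_trans.
exists z => [|w]; rewrite inE ?zl ?orbT// => /predU1P[->|/zmin//].
exact: ltW.
Qed.

(** The terms of minimal exponent dominate the others by a power of ln t, so
    their polynomials add up to a polynomial that vanishes at infinity: they
    cancel, and the remaining list is shorter. *)
Lemma loglog_coef_eq0 l :
  (forall g e, 0 < e -> \forall t \near +oo, `|ln t `^ g * loglog_coef l t| <= e) ->
  \forall t \near +oo, loglog_coef l t = 0.
Proof.
have [m] := ubnP (size l); elim: m l => // m IHm l; rewrite ltnS => lm vanish.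
have [->|lN0] := eqVneq l [::].
  by near=> t; rewrite /loglog_coef big_nil.
have [x0 x0l x0min] := exists_min_exponent lN0.
(* The list may repeat the minimal exponent; only the sum P of all the polynomials
   that go with it has to vanish. *)
pose P := \sum_(x <- l | x.1 == x0.1) x.2.
pose l1 := [seq x <- l | x.1 != x0.1].
have splitl t : loglog_coef l t = ln t `^ (- x0.1) * P.[ln (ln t)] + loglog_coef l1 t.
  rewrite /loglog_coef (bigID (fun x => x.1 == x0.1))/= big_filter; congr (_ + _).
  rewrite /P horner_sum mulr_sumr; apply: eq_bigr => x /eqP ->.
  exact: loglog_term0E.
have vanish1 e : 0 < e -> \forall t \near +oo, `|ln t `^ x0.1 * loglog_coef l1 t| <= e.
  have : forall x, x \in l1 -> x0.1 < x.1.
    by move=> x; rewrite mem_filter => /andP[xx0 /x0min]; rewrite lt_neqAle eq_sym xx0.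
  elim: (l1) e => [|x l' IHl'] e lt_l e0.
    by near=> t; rewrite /loglog_coef big_nil mulr0 normr0 ltW.
  have e2 : 0 < e / 2 by rewrite divr_gt0.
  have xx0 : 0 < x.1 - x0.1 by rewrite subr_gt0 lt_l// inE eqxx.
  have lt_l' y : y \in l' -> x0.1 < y.1 by move=> yl; rewrite lt_l// inE yl orbT.
  near=> t; have lt0 : 0 < ln t by near: t; exact: (near_ln (near_pinfty_gt 0)).
  rewrite /loglog_coef big_cons mulrDr (le_trans (ler_normD _ _))//.
  rewrite [leRHS](splitr e) lerD//; last by near: t; exact: IHl'.
  have -> : ln t `^ x0.1 * loglog_term 0 x.1 x.2 t = loglog_term 0 (x.1 - x0.1) x.2 t.
    rewrite !loglog_term0E mulrA -powRD ?(gt_eqF lt0) ?implybT//.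
    by congr (_ `^ _ * _); ring.
  by near: t; exact: lnln_term_vanish.
have P0 : P = 0.
  apply: poly_vanish_lnln => e e0; have e2 : 0 < e / 2 by rewrite divr_gt0.
  have V := vanish x0.1 _ e2; have V1 := vanish1 _ e2.
  near=> t; have lt0 : 0 < ln t by near: t; exact: (near_ln (near_pinfty_gt 0)).
  have -> : P.[ln (ln t)] = ln t `^ x0.1 * loglog_coef l t - ln t `^ x0.1 * loglog_coef l1 t.
    by rewrite splitl powRN; field; rewrite gt_eqF ?powR_gt0.
  rewrite (le_trans (ler_normB _ _))// [leRHS](splitr e) lerD//; by near: t.
have eql1 t : loglog_coef l t = loglog_coef l1 t by rewrite splitl P0 horner0 mulr0 add0r.
have : \forall t \near +oo, loglog_coef l1 t = 0.
  apply: IHm => [|g e /(vanish g)]; last by apply: filterS => t; rewrite eql1.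
  apply: leq_trans lm; rewrite -(count_predC (fun x => x.1 == x0.1) l) size_filter.
  rewrite -[X in (X < _)%N]add0n ltn_add2r -has_count.
  by apply/hasP; exists x0.
by apply: filterS => t; rewrite eql1.
Unshelve. all: by end_near. Qed.

(** Decay like a power of t beats every power of ln t. *)
Lemma loglog_coef_decays_eq0 l e : 0 < e -> decays e (loglog_coef l) ->
  \forall t \near +oo, loglog_coef l t = 0.
Proof.
move=> e0 dl; apply: loglog_coef_eq0 => g e1 e10.
have e2 : 0 < e / 2 by rewrite divr_gt0.
apply: (decays_vanish e2 _ e10).
(* For positive g, ln t is bounded by a multiple of t^c with c g = e / 2. *)
have lng : decays (- (e / 2)) (fun t => ln t `^ g).
  have [g0|g0] := leP g 0.
    have := @decays_loglog_term R 0 (- g) 1 (- (e / 2)).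
    rewrite oppr_lt0 oppr_ge0 => /(_ e2 g0); apply: decays_eq.
    by near=> t; rewrite loglog_term0E opprK hornerE mulr1.
  pose c := e / 2 / g; have c0 : 0 < c by rewrite divr_gt0.
  exists ((c^-1) `^ g); near=> t.
  have t0 : 0 < t by near: t; exact: near_pinfty_gt.
  rewrite opprK ger0_norm ?powR_ge0//.
  have -> : t `^ (e / 2) = (t `^ c) `^ g.
    by rewrite -powRrM /c divfK// gt_eqF.
  rewrite -powRM ?powR_ge0 ?invr_ge0 ?(ltW c0)//.
  have lt0 : 0 < ln t by near: t; exact: (near_ln (near_pinfty_gt 0)).
  apply: ge0_ler_powR; [exact: ltW|by rewrite nnegrE ltW| |exact: ln_le_powR].
  by rewrite nnegrE mulr_ge0 ?powR_ge0 ?invr_ge0// ltW.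
have -> : e / 2 = - (e / 2) + e by field.
exact: decaysM.
Unshelve. all: by end_near. Qed.
End Coefficients.

Section Expansions.
Variables (R : realType) (mu : nat -> R).
Hypothesis mu_incr : forall k l, (k < l)%N -> mu k < mu l.
Implicit Types (u v : R -> R) (c : nat -> seq (R * {poly R})).

Definition nonneg_exponents c := forall k, all (fun x => 0 <= x.1) (c k).

Definition partial_sum c N t : R :=
  \sum_(k < N.+1) t `^ (- mu k) * loglog_coef (c k) t.

Definition expands u N c :=
  exists2 nu : R, mu N < nu & decays nu (fun t => u t - partial_sum c N t).

Lemma mu_le k l : (k <= l)%N -> mu k <= mu l.
Proof. by rewrite leq_eqVlt => /predU1P[->//|/mu_incr/ltW]. Qed.

Lemma decays_rank c k nu : nonneg_exponents c -> nu < mu k ->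
  decays nu (fun t => t `^ (- mu k) * loglog_coef (c k) t).
Proof.
move=> c0 numu; have -> : nu = mu k + (nu - mu k) by ring.
apply: decaysM; first exact: decays_powR.
by apply: loglog_coef_decays => //; rewrite subr_lt0.
Qed.

Lemma expands_trunc u N M c : nonneg_exponents c -> (N <= M)%N ->
  expands u M c -> expands u N c.
Proof.
move=> c0 /subnK <-; elim: (M - N)%N => // d IHd.
rewrite addSn => -[nu munu dec]; apply: IHd.
have lt1 := mu_incr (ltnSn (d + N)).
(* The dropped term decays faster than the midpoint of its exponent and the
   previous one. *)
exists ((mu (d + N) + mu (d + N).+1) / 2); first lra.
have dec' : decays ((mu (d + N) + mu (d + N).+1) / 2)
    (fun t => t `^ (- mu (d + N).+1) * loglog_coef (c (d + N).+1) t).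
  by apply: decays_rank => //; lra.
apply: decays_eq (decaysD (decays_weak _ dec) dec'); last lra.
by near=> t; rewrite /partial_sum [in LHS]big_ord_recr/=; ring.
Unshelve. all: by end_near. Qed.

(** The term of lowest rank dominates all later ones by a power of t. *)
Lemma partial_sum_eq0 c N nu : nonneg_exponents c -> mu N < nu ->
  decays nu (partial_sum c N) ->
  forall k, (k <= N)%N -> \forall t \near +oo, loglog_coef (c k) t = 0.
Proof.
move=> c0 munu dec; elim/ltn_ind => k IHk kN.
have ltk := mu_incr (ltnSn k); have lek := mu_le kN.
have [m km [mnu mk1]] : exists2 m, mu k < m & m <= nu /\ m < mu k.+1.
  have [h|h] := leP nu (mu k.+1); [exists ((mu k + nu) / 2)|exists ((mu k + mu k.+1) / 2)]; lra.
pose rest t := \sum_(j < N.+1 | j != inord k) t `^ (- mu j) * loglog_coef (c j) t.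
have drest : decays m rest.
  apply: decays_sum => j; rewrite -(inj_eq val_inj)/= inordK ?ltnS// => jk.
  have [ltjk|] := ltnP j k; last rewrite leq_eqVlt eq_sym (negbTE jk)/= => ltkj.
    have z : \forall t \near +oo, loglog_coef (c j) t = 0.
      by apply: IHk; rewrite // (leq_trans _ kN)// ltnW.
    by apply: decays_eq (decays0 m); apply: filterS z => t ->; rewrite mulr0.
  by apply: decays_rank => //; apply: lt_le_trans mk1 (mu_le ltkj).
have dk : decays m (fun t => t `^ (- mu k) * loglog_coef (c k) t).
  apply: decays_eq (decaysB (decays_weak mnu dec) drest).
  near=> t; rewrite /partial_sum (bigD1 (inord k))//= inordK ?ltnS// -/(rest t).
  by rewrite addrK.
apply: (@loglog_coef_decays_eq0 _ _ (m - mu k)); first by rewrite subr_gt0.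
have dp := decays_powR (- mu k); rewrite addrC.
apply: decays_eq (decaysM dp dk); near=> t.
have t0 : 0 < t by near: t; exact: near_pinfty_gt.
by rewrite mulrA -powRD ?(gt_eqF t0) ?implybT// opprK addrN powRr0 mul1r.
Unshelve. all: by end_near. Qed.

Lemma expands_unique u N c c' : nonneg_exponents c -> nonneg_exponents c' ->
  expands u N c -> expands u N c' ->
  forall k, (k <= N)%N -> \forall t \near +oo, loglog_coef (c k) t = loglog_coef (c' k) t.
Proof.
move=> c0 c'0 [nu munu dec] [nu' munu' dec'] k kN.
pose d k := c k ++ [seq (x.1, - x.2) | x <- c' k].
have dE j t : loglog_coef (d j) t = loglog_coef (c j) t - loglog_coef (c' j) t.
  by rewrite loglog_coef_cat loglog_coef_opp.
have d0 : nonneg_exponents d.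
  by move=> j; rewrite /d all_cat c0/= all_map; exact: c'0.
have : \forall t \near +oo, loglog_coef (d k) t = 0.
  apply: (@partial_sum_eq0 d N (Num.min nu nu')) => //; first by rewrite lt_min munu.
  have w : Num.min nu nu' <= nu by rewrite ge_min lexx.
  have w' : Num.min nu nu' <= nu' by rewrite ge_min lexx orbT.
  apply: decays_eq (decaysB (decays_weak w' dec') (decays_weak w dec)).
  near=> t; rewrite /partial_sum.
  under [RHS]eq_bigr do rewrite dE mulrBr.
  by rewrite sumrB; ring.
by apply: filterS => t /eqP; rewrite dE subr_eq0 => /eqP.
Unshelve. all: by end_near. Qed.

(** Uniqueness makes the coefficients of expansions of different lengths agree,
    so the coefficient of rank k may be read off the expansion of length k. *)
Lemma expands_coherent u :
  (forall N, exists2 c, nonneg_exponents c & expands u N c) ->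
  exists2 c, nonneg_exponents c & forall N, expands u N c.
Proof.
move=> expu.
have /choice[C HC] : forall N, exists c, nonneg_exponents c /\ expands u N c.
  by move=> N; have [c c0 ec] := expu N; exists c.
exists (fun k => C k k) => [k|N].
  by have [c0 _] := HC k; exact: c0.
have [c0 [nu munu dec]] := HC N; exists nu => //; apply: decays_eq dec.
have : \forall t \near +oo, forall k : 'I_N.+1, loglog_coef (C N k) t = loglog_coef (C k k) t.
  apply: filter_forall => k.
  have [ck0 ek] := HC k; have [cN0 eN] := HC N.
  have kN : (k <= N)%N by rewrite -ltnS.
  exact: (expands_unique cN0 ck0 (expands_trunc cN0 kN eN) ek).
apply: filterS => t Ht; congr (_ - _); apply: eq_bigr => k _.
by rewrite Ht.
Qed.

Lemma loglog_span_expands s u N : loglog_span (range mu) s u ->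
  exists2 c, nonneg_exponents c & expands u N c.
Proof.
have ltN := mu_incr (ltnSn N).
(* The midpoint lies above mu N and below the exponent of every discarded term. *)
pose nu := (mu N + mu N.+1) / 2.
suff : loglog_span (range mu) s u -> exists2 c, nonneg_exponents c &
    decays nu (fun t => u t - partial_sum c N t).
  by move=> H /H[c c0 dec]; exists c => //; exists nu => //; rewrite /nu; lra.
elim=> {u} [|_ g p [j _ <-] sa g0|u v _ [c c0 dc] _ [c' c'0 dc']|u v uv _ [c c0 dc]].
- exists (fun=> [::]) => //; apply: decays_eq (decays0 nu); near=> t.
  by rewrite /partial_sum big1 ?subr0// => k _; rewrite /loglog_coef big_nil mulr0.
- have termE t : loglog_term (mu j) g p t = t `^ (- mu j) * loglog_coef [:: (g, p)] t.
    by rewrite /loglog_coef big_seq1/= loglog_term0E mulrA.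
  pose c k := if k == j then [:: (g, p)] else [::].
  have c0 : nonneg_exponents c by move=> k; rewrite /c; case: ifP => //=; rewrite g0.
  exists c => //.
  have [jN|Nj] := leqP j N.
    apply: decays_eq (decays0 nu); near=> t.
    rewrite /partial_sum (bigD1 (inord j))//= inordK ?ltnS// big1 ?addr0.
      by rewrite /c eqxx -termE subrr.
    move=> k; rewrite -(inj_eq val_inj)/= inordK ?ltnS// => /negbTE kj.
    by rewrite /c kj /loglog_coef big_nil mulr0.
  have numu : nu < mu j by apply: lt_le_trans (mu_le Nj); rewrite /nu; lra.
  apply: decays_eq (decays_rank c0 numu).
  near=> t; rewrite {1}/c eqxx termE /partial_sum big1 ?subr0// => k _.
  by rewrite /c ltn_eqF ?(leq_trans (ltn_ord k))// /loglog_coef big_nil mulr0.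
- exists (fun k => c k ++ c' k) => [k|]; first by rewrite all_cat c0 c'0.
  apply: decays_eq (decaysD dc dc'); near=> t; rewrite /partial_sum.
  under [X in _ = _ - X]eq_bigr do rewrite loglog_coef_cat mulrDr.
  by rewrite big_split/=; ring.
- by exists c => //; apply: decays_eq dc; apply: filterS uv => t ->.
Unshelve. all: by end_near. Qed.

Lemma expands_decays u v N c : decays (mu N.+1) (fun t => u t - v t) ->
  expands v N c -> expands u N c.
Proof.
move=> uv [nu munu dec]; have ltN := mu_incr (ltnSn N).
exists (Num.min nu (mu N.+1)); first by rewrite lt_min munu.
have w : Num.min nu (mu N.+1) <= nu by rewrite ge_min lexx.
have w' : Num.min nu (mu N.+1) <= mu N.+1 by rewrite ge_min lexx orbT.
apply: decays_eq (decaysD (decays_weak w' uv) (decays_weak w dec)).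
by near=> t; ring.
Unshelve. all: by end_near. Qed.

End Expansions.

(** * A priori decay *)

Section Apriori.
Variables (R : realType) (n : nat).

Lemma sum_sqr_le (r : seq 'I_n) (a : 'I_n -> R) :
  \sum_(i <- r) a i ^+ 2 <= (\sum_(i <- r) `|a i|) ^+ 2.
Proof.
elim: r => [|i r IHr]; first by rewrite !big_nil expr0n.
rewrite !big_cons sqrrD real_normK ?num_real// -addrA lerD2l (le_trans IHr)//.
by rewrite lerDr mulrn_wge0// mulr_ge0// sumr_ge0.
Qed.

Lemma coord_le_enorm (v : 'cV[R]_n) i : `|v i 0| <= enorm v.
Proof.
rewrite /enorm -sqrtr_sqr ler_wsqrtr// (bigD1 i)//= lerDl.
by apply: sumr_ge0 => j _; exact: sqr_ge0.
Qed.

Lemma enorm_le_sum (v : 'cV[R]_n) : enorm v <= \sum_(i < n) `|v i 0|.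
Proof.
rewrite /enorm -[leRHS]ger0_norm ?sumr_ge0// -sqrtr_sqr.
by rewrite ler_wsqrtr// sum_sqr_le.
Qed.

Lemma enorm_le (v : 'cV[R]_n) b : (forall i, `|v i 0| <= b) -> enorm v <= n%:R * b.
Proof.
move=> vb; rewrite (le_trans (enorm_le_sum v))//.
by rewrite (le_trans (ler_sum _ (fun i _ => vb i)))// sumr_const card_ord mulr_natl.
Qed.

Lemma bigO_infty_decays (g : R -> 'cV[R]_n) nu : bigO_infty g (fun t => t `^ (- nu)) <->
  forall i, decays nu (fun t => g t i 0).
Proof.
split=> [[T [C [T0 C0 gC]]] i|dg].
  exists C; apply/near_pinftyP; exists T => // t /gC.
  exact: le_trans (coord_le_enorm _ i).
have [D HD] : exists D, \forall t \near +oo, enorm (g t) <= D * t `^ (- nu).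
  have [D HD] : decays nu (fun t => \sum_(i < n) `|g t i 0|).
    apply: decays_sum => i _; have [C gC] := dg i; exists C.
    by apply: filterS gC => t; rewrite normr_id.
  exists D; apply: filterS HD => t; apply: le_trans.
  by rewrite ger0_norm ?sumr_ge0// enorm_le_sum.
have /near_pinftyP[T T0 HT] := HD.
exists T, (`|D| + 1); split=> // t Tt.
rewrite (le_trans (HT _ Tt))// ler_wpM2r ?powR_ge0//.
by rewrite (le_trans (ler_norm D))// lerDl.
Qed.

Lemma mulmx_decays (M : 'M[R]_n) (g : R -> 'cV[R]_n) nu :
  (forall i, decays nu (fun t => g t i 0)) ->
  forall i, decays nu (fun t => (M *m g t) i 0).
Proof.
move=> dg i; under eq_fun do rewrite mxE.
by apply: decays_sum => j _; exact: decaysZ.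
Qed.

Lemma mulmx_loglog_span (S : set R) (M : 'M[R]_n) (g : R -> 'cV[R]_n) s :
  (forall i, loglog_span S s (fun t => g t i 0)) ->
  forall i, loglog_span S s (fun t => (M *m g t) i 0).
Proof.
move=> dg i; under eq_fun do rewrite mxE.
by apply: loglog_span_sum => j _; exact: loglog_spanZ.
Qed.

Lemma mulmx_bound (M : 'M[R]_n) : exists2 C : R, 0 <= C &
  forall (v : 'cV[R]_n) b, 0 <= b -> (forall i, `|v i 0| <= b) ->
  forall i, `|(M *m v) i 0| <= C * b.
Proof.
exists (\sum_(i < n) \sum_(j < n) `|M i j|) => [|v b b0 vb i].
  by do 2 apply: sumr_ge0 => ? _.
rewrite mxE (le_trans (ler_norm_sum _ _ _))//.
apply: (@le_trans _ _ (\sum_(j < n) `|M i j| * b)).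
  by apply: ler_sum => j _; rewrite normrM ler_wpM2l.
rewrite -mulr_suml ler_wpM2r// [leRHS](bigD1 i)//= lerDl.
by do 2 apply: sumr_ge0 => ? _.
Qed.

(** With m the least d_i, the energy V = sum_i w_i^2 satisfies
    V' <= - m V + O(t^(-2s)). Of the dissipation 2 m V, the terms a_i take a quarter
    once w is small, and Young's inequality spends another quarter on the forcing
    terms b_i. *)
Lemma apriori_decay (d : 'I_n -> R) (w a b dw : 'I_n -> R -> R) (C s : R) :
  (forall i, 0 < d i) -> 0 <= C -> 0 <= s ->
  (forall i, \forall t \near +oo, is_derive (t : R) 1 (w i) (dw i t)) ->
  (forall i, \forall t \near +oo, dw i t = - d i * w i t + a i t + b i t) ->
  (forall i, \forall t \near +oo, `|a i t| <= C * \sum_(j < n) w j t ^+ 2) ->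
  (forall i e, 0 < e -> \forall t \near +oo, `|w i t| <= e) ->
  (forall i, decays s (b i)) -> forall i, decays s (w i).
Proof.
move=> d0 C0 s0 Dw eqw aC w_lim bs.
pose m := \big[Order.min/1]_(i < n) d i.
have m0 : 0 < m by apply: lt_bigmin => [|i _]; [exact: ltr01|exact: d0].
have md i : m <= d i by exact: bigmin_le.
pose V t := \sum_(i < n) w i t ^+ 2.
have V0 t : 0 <= V t by apply: sumr_ge0 => i _; exact: sqr_ge0.
pose e := m / (4 * (n%:R + 1) * (C + 1)).
have e0 : 0 < e by rewrite divr_gt0// !mulr_gt0// ltr_wpDl.
have eC : n%:R * (2 * e * C) <= m / 2.
  have -> : m / 2 = (n%:R + 1) * (2 * e * (C + 1)).
    by rewrite /e; field; rewrite !gt_eqF// ltr_wpDl.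
  apply: ler_pM => //; first by rewrite mulr_ge0// mulr_ge0// ltW.
    by rewrite lerDl.
  by rewrite ler_wpM2l ?lerDl// mulr_ge0// ltW.
have [B HB] : decays (s + s) (fun t => \sum_(i < n) 2 / m * (b i t * b i t)).
  by apply: decays_sum => i _; apply: decaysZ; exact: decaysM.
have [K HK] : exists K : R, \forall t \near +oo, V t <= K * t `^ (- (s + s)).
  apply: (@upper_decay _ m (s + s) B V (fun t => \sum_(i < n) 2 * w i t * dw i t)) => //.
  - exact: addr_ge0.
  - have HD : \forall t \near +oo, forall i, is_derive (t : R) 1 (w i) (dw i t).
      exact: filter_forall.
    near=> t.
    have Dt : forall i, is_derive t 1 (w i) (dw i t) by near: t.
    have -> : V = \sum_(i < n) (w i * w i).
      by apply/funext => x; rewrite fct_sumE; apply: eq_bigr => i _; rewrite expr2.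
    apply: is_derive_sum => i.
    apply: (is_derive_eq (is_deriveM (Dt i) (Dt i))).
    by rewrite /GRing.scale/=; ring.
  - have Hi : \forall t \near +oo, forall i : 'I_n, [/\ dw i t = - d i * w i t + a i t + b i t,
       `|a i t| <= C * V t & `|w i t| <= e].
      apply: filter_forall => i; near=> t; split; near: t.
      + exact: eqw.
      + exact: aC.
      + exact: w_lim.
    near=> t.
    have Ht : forall i : 'I_n, [/\ dw i t = - d i * w i t + a i t + b i t,
       `|a i t| <= C * V t & `|w i t| <= e] by near: t.
    apply: (@le_trans _ _ (- m * V t + \sum_(i < n) 2 / m * (b i t * b i t))); last first.
      rewrite lerD2l (le_trans (ler_norm _))//; by near: t.
    have -> : - m * V t = \sum_(i < n) (- (3 / 2 * m) * w i t ^+ 2) + m / 2 * V t.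
      by rewrite -mulr_sumr -/(V t); field.
    apply: (@le_trans _ _ (\sum_(i < n) (- (3 / 2 * m) * w i t ^+ 2)
        + n%:R * (2 * e * C) * V t + \sum_(i < n) 2 / m * (b i t * b i t))); last first.
      by rewrite lerD2r lerD2l ler_wpM2r.
    have -> : n%:R * (2 * e * C) * V t = \sum_(i < n) 2 * e * C * V t.
      by rewrite sumr_const card_ord -mulr_natl; ring.
    rewrite -!big_split/=; apply: ler_sum => i _.
    have [-> ai wi] := Ht i.
    have waC : 2 * (w i t * a i t) <= 2 * (e * (C * V t)).
      by rewrite ler_pM2l// (le_trans (ler_norm _))// normrM ler_pM.
    have wd : m * w i t ^+ 2 <= d i * w i t ^+ 2 by rewrite ler_wpM2r ?sqr_ge0.
    have young : 2 * (w i t * b i t) <= m / 2 * w i t ^+ 2 + 2 / m * (b i t * b i t).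
      rewrite -subr_ge0.
      have -> : m / 2 * w i t ^+ 2 + 2 / m * (b i t * b i t) - 2 * (w i t * b i t)
          = m / 2 * (w i t - 2 / m * b i t) ^+ 2 by field; rewrite gt_eqF.
      by rewrite mulr_ge0 ?sqr_ge0// divr_ge0// ltW.
    rewrite (_ : 2 * w i t * _ = - 2 * (d i * w i t ^+ 2) + 2 * (w i t * a i t)
       + 2 * (w i t * b i t)); last by ring.
    lra.
move=> i; exists (Num.sqrt `|K|); near=> t.
have -> : t `^ (- s) = Num.sqrt (t `^ (- (s + s))).
  rewrite -[X in X = _]ger0_norm ?powR_ge0// -sqrtr_sqr expr2 -powRD ?opprD//.
  by apply/implyP => _; rewrite gt_eqF//; near: t; exact: near_pinfty_gt.
rewrite -sqrtrM// -sqrtr_sqr ler_wsqrtr//.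
apply: (@le_trans _ _ (V t)).
  by rewrite /V (bigD1 i)//= lerDl; apply: sumr_ge0 => j _; exact: sqr_ge0.
apply: (@le_trans _ _ (K * t `^ (- (s + s)))); first by near: t.
by rewrite ler_wpM2r ?powR_ge0 ?ler_norm.
Unshelve. all: by end_near. Qed.

End Apriori.

(** * The equation *)

Section Equation.
Variables (R : realType) (n : nat).
Variables (G : 'cV[R]_n -> 'cV[R]_n) (Gm : nat -> 'cV[R]_n -> 'cV[R]_n).
Hypothesis hGm : homogeneous_expansion G Gm.

Lemma expansion_remainder N : (2 <= N)%N -> exists r C : R, [/\ 0 < r, 0 <= C &
  forall (y : 'cV[R]_n) b, 0 <= b <= r -> (forall i, `|y i 0| <= b) ->
  forall i, `|G y i 0 - \sum_(2 <= m < N.+1) Gm m y i 0| <= C * b ^+ N].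
Proof.
move=> N2; have [_ /(_ N N2)[delta delta0 [r0 [C [r00 C0 HC]]]]] := hGm.
have n1 : 0 < n%:R + 1 :> R by rewrite ltr_wpDl.
pose r := Num.min (r0 / 2) 1 / (n%:R + 1).
exists r, (C * n%:R ^+ N); split.
- by rewrite divr_gt0// lt_min ltr01 divr_gt0.
- by rewrite mulr_ge0 ?exprn_ge0// ltW.
move=> y b /andP[b0 br] yb i.
have yn : enorm y <= n%:R * b by exact: enorm_le.
have nb : n%:R * b <= Num.min (r0 / 2) 1.
  apply: (@le_trans _ _ ((n%:R + 1) * b)); first by rewrite ler_wpM2r ?lerDl.
  by rewrite mulrC -ler_pdivlMr.
have y1 : enorm y <= 1 by rewrite (le_trans yn)// (le_trans nb)// ge_min lexx orbT.
have yr : enorm y < r0.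
  rewrite (le_lt_trans yn)// (le_lt_trans nb)// (@le_lt_trans _ _ (r0 / 2))//.
    by rewrite ge_min lexx.
  by lra.
have y0 : 0 <= enorm y by exact: sqrtr_ge0.
have yN : enorm y `^ (N%:R + delta) <= enorm y ^+ N.
  move: y0; rewrite le_eqVlt => /predU1P[<-|y0].
    by rewrite powR0 ?exprn_ge0// gt_eqF// ltr_wpDl.
  have yy : 0 < enorm y <= 1 by rewrite y0.
  have Nd : N%:R <= N%:R + delta by rewrite lerDl ltW.
  by rewrite -powR_mulrn ?(ltW y0)//; exact: ger_powR yy _ _ Nd.
have -> : G y i 0 - \sum_(2 <= m < N.+1) Gm m y i 0
        = (G y - \sum_(2 <= m < N.+1) Gm m y) i 0 by rewrite !mxE summxE.
rewrite (le_trans (coord_le_enorm _ i))// (le_trans (HC _ yr))//.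
rewrite -mulrA ler_pM2l// (le_trans yN)// -exprMn lerXn2r// nnegrE.
by rewrite mulr_ge0.
Qed.

Lemma expansion_quadratic : exists r C : R, [/\ 0 < r, 0 <= C &
  forall (y : 'cV[R]_n) b, 0 <= b <= r -> (forall i, `|y i 0| <= b) ->
  forall i, `|G y i 0| <= C * b ^+ 2].
Proof.
have [r [C [r0 C0 HC]]] := expansion_remainder (leqnn 2).
have HF i : homfun 2 (fun y => Gm 2 y i 0).
  by apply: homogeneous_homfun => //; apply: hGm.1.
have /choice[D HD] : forall i, exists D : R, 0 <= D /\
    forall (b : R) (y : 'cV[R]_n), 0 <= b -> (forall i, `|y i 0| <= b) ->
      `|Gm 2 y i 0| <= D * b ^+ 2.
  by move=> i; have [D D0 H] := homfun_bound (HF i); exists D.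
exists r, (C + \sum_(i < n) D i); split=> //.
  by rewrite addr_ge0// sumr_ge0// => i _; exact: (HD i).1.
move=> y b br yb i; have := HC y b br yb i; rewrite big_nat1 => H1.
have b0 : 0 <= b by case/andP: br.
have H2 := (HD i).2 b y b0 yb.
have H3 : D i * b ^+ 2 <= (\sum_(i < n) D i) * b ^+ 2.
  rewrite ler_wpM2r ?exprn_ge0// (bigD1 i)//= lerDl.
  by apply: sumr_ge0 => j _; exact: (HD j).1.
rewrite -[G y i 0](subrK (Gm 2 y i 0)) (le_trans (ler_normD _ _))// mulrDl lerD//.
exact: le_trans H3.
Qed.

(** Replacing y by its approximation Y of order rho in G changes it only to order
    rho + s, because every monomial of G_m has at least one factor of order s besides
    the difference y - Y. *)
Lemma nonlinearity_approx (S : set R) (y Y : R -> 'cV[R]_n) s rho :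
  0 < s -> s <= rho -> (forall a b, S a -> S b -> S (a + b)) ->
  (forall i, decays s (fun t => y t i 0)) ->
  (forall i, decays rho (fun t => y t i 0 - Y t i 0)) ->
  (forall i, loglog_span S 0 (fun t => Y t i 0)) ->
  forall i, exists2 H, loglog_span S 0 H & decays (rho + s) (fun t => G (y t) i 0 - H t).
Proof.
move=> s0 srho SD sy syY spY i.
have sY j : decays s (fun t => Y t j 0).
  apply: decays_eq (decaysB (sy j) (decays_weak srho (syY j))).
  by near=> t; ring.
(* G is expanded until its remainder, which is O(|y|^N), is negligible. *)
have [N N2 Ns] : exists2 N, (2 <= N)%N & rho + s <= N%:R * s.
  exists (Num.truncn ((rho + s) / s)).+2 => //.
  rewrite -ler_pdivrMr//; apply: ltW; rewrite (lt_le_trans (truncnS_gt _))//.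
  by rewrite ler_nat.
have [r [C [r0 C0 HC]]] := expansion_remainder N2.
have HF m : (2 <= m)%N -> homfun m (fun y => Gm m y i 0).
  by move=> m2; apply: homogeneous_homfun; [exact: ltnW|exact: hGm.1].
exists (fun t => \sum_(2 <= m < N.+1) Gm m (Y t) i 0).
  rewrite (_ : (fun t => _) = fun t => \sum_(m <- index_iota 2 N.+1 | (2 <= m)%N) Gm m (Y t) i 0).
    by apply: loglog_span_sum => m /HF; exact: homfun_loglog_span.
  apply/funext => t; rewrite big_seq [RHS]big_seq_cond; apply: eq_bigl => m.
  by rewrite mem_index_iota; case: (2 <= m)%N; rewrite ?andbT.
have d1 : decays (rho + s) (fun t => \sum_(m <- index_iota 2 N.+1 | (2 <= m)%N)
     (Gm m (y t) i 0 - Gm m (Y t) i 0)).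
  apply: decays_sum => m m2; apply: decays_weak (homfun_diff_decays sy sY syY (HF m m2)).
  have m1 : 1 <= m%:R - 1 :> R by rewrite lerBrDr -[1 + 1]/(2%:R) ler_nat.
  by rewrite lerD2l ler_peMl// ltW.
have d2 : decays (rho + s) (fun t => G (y t) i 0 - \sum_(2 <= m < N.+1) Gm m (y t) i 0).
  apply: decays_weak Ns _.
  have [B B0 HB] : exists2 B : R, 0 <= B & \forall t \near +oo, forall j, `|y t j 0| <= B * t `^ (- s).
    have /choice[B HB] : forall j, exists B : R, \forall t \near +oo, `|y t j 0| <= B * t `^ (- s).
      by move=> j; exact: sy.
    exists (\sum_j `|B j|); first exact: sumr_ge0.
    apply: filter_forall => j; apply: filterS (HB j) => t /le_trans; apply.
    rewrite ler_wpM2r ?powR_ge0// (le_trans (ler_norm _))// (bigD1 j)//= lerDl.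
    exact: sumr_ge0.
  have small := decays_vanish s0 (decaysZ B (decays_powR s)) r0.
  exists (C * B ^+ N); near=> t.
  have t0 : 0 < t by near: t; exact: near_pinfty_gt.
  have -> : C * B ^+ N * t `^ (- (N%:R * s)) = C * (B * t `^ (- s)) ^+ N.
    rewrite exprMn mulrA; congr (_ * _).
    by rewrite -powR_mulrn ?powR_ge0// -powRrM; congr (_ `^ _); ring.
  apply: HC; last by near: t.
  rewrite mulr_ge0 ?powR_ge0//= (le_trans (ler_norm _))//; by near: t.
apply: decays_eq (decaysD d2 d1); near=> t.
have -> : \sum_(m <- index_iota 2 N.+1 | (2 <= m)%N) (Gm m (y t) i 0 - Gm m (Y t) i 0)
   = \sum_(2 <= m < N.+1) (Gm m (y t) i 0 - Gm m (Y t) i 0).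
  rewrite big_seq_cond [RHS]big_seq; apply: eq_bigl => m.
  by rewrite mem_index_iota; case: (2 <= m)%N; rewrite ?andbT.
by rewrite sumrB addrA subrK.
Unshelve. all: by end_near. Qed.

End Equation.

Section Solution.
Variables (R : realType) (n : nat) (A S : 'M[R]_n) (d : 'rV[R]_n).
Hypotheses (S_unit : S \in unitmx) (d_gt0 : forall i, 0 < d 0 i).
Hypothesis A_diag : A = invmx S *m diag_mx d *m S.
Variables (G : 'cV[R]_n -> 'cV[R]_n) (Gm : nat -> 'cV[R]_n -> 'cV[R]_n).
Hypothesis hGm : homogeneous_expansion G Gm.
Variables (f y : R -> 'cV[R]_n) (T0 : R).
Hypothesis hy : C1_solution A G f T0 y.
Hypothesis y_lim : y t @[t --> +oo] --> (0 : 'cV[R]_n).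

Lemma is_derive_diagonal i : \forall t \near +oo,
  is_derive (t : R) 1 (fun t => (S *m y t) i 0)
    (- d 0 i * (S *m y t) i 0 + (S *m G (y t)) i 0 + (S *m f t) i 0).
Proof.
near=> t.
have T0t : T0 < t by near: t; exact: near_pinfty_gt.
have [Dy _ eqy] := hy T0t.
have Dj j : is_derive t 1 (fun t => y t j 0) (derive1 y t j 0).
  apply: DeriveDef; first by have /derivable_mxP := Dy; exact.
  by rewrite derive1E derive_mx// mxE.
have -> : (fun t => (S *m y t) i 0) = \sum_(j < n) (S i j \*: (fun t => y t j 0)).
  by apply/funext => x; rewrite mxE fct_sumE.
apply: (is_derive_eq (is_derive_sum (fun j => is_deriveZ (S i j) (Dj j)))).
have -> : \sum_(j < n) S i j *: derive1 y t j 0 = (S *m derive1 y t) i 0 by rewrite mxE.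
rewrite eqy A_diag !mulmxDr mulmxN !mulmxA mulmxV// mul1mx -mulmxA mul_diag_mx.
by rewrite !mxE mulNr.
Unshelve. all: by end_near. Qed.

Lemma solution_vanish i e : 0 < e -> \forall t \near +oo, `|y t i 0| <= e.
Proof.
move=> e0; have /cvgrPdist_le/(_ _ e0) := y_lim; apply: filterS => t.
by rewrite sub0r normrN /Num.norm/= mx_normrE => /bigmax_leP[_ /(_ (i, ord0) isT)].
Qed.

Lemma diagonal_coordsK t : y t = invmx S *m (S *m y t).
Proof. by rewrite mulmxA mulVmx// mul1mx. Qed.

Lemma solution_decays s : 0 <= s -> (forall i, decays s (fun t => f t i 0)) ->
  forall i, decays s (fun t => y t i 0).
Proof.
move=> s0 fs.
suff ws : forall i, decays s (fun t => (S *m y t) i 0).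
  move=> i; under eq_fun do rewrite diagonal_coordsK; exact: mulmx_decays ws i.
have [r [C [r0 C0 HG]]] := expansion_quadratic hGm.
have [CS CS0 HS] := mulmx_bound S.
have [CI CI0 HI] := mulmx_bound (invmx S).
have w_lim e : 0 < e -> \forall t \near +oo, forall i, `|(S *m y t) i 0| <= e.
  move=> e0; have CS1 : 0 < CS + 1 by rewrite ltr_wpDl.
  have eC : 0 < e / (CS + 1) by rewrite divr_gt0.
  have H : \forall t \near +oo, forall j, `|y t j 0| <= e / (CS + 1).
    by apply: filter_forall => j; exact: solution_vanish.
  apply: filterS H => t H i; apply: (le_trans (HS _ _ (ltW eC) H i)).
  by rewrite mulrA ler_pdivrMr// mulrC ler_wpM2l ?lerDl// ltW.
apply: (@apriori_decay _ _ (fun i => d 0 i) (fun i t => (S *m y t) i 0)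
  (fun i t => (S *m G (y t)) i 0) (fun i t => (S *m f t) i 0) _ (CS * (C * CI ^+ 2)) s) => //.
- by rewrite !mulr_ge0.
- by move=> i; exact: is_derive_diagonal.
- by move=> i; near=> t.
- move=> i; pose b t := CI * enorm (S *m y t).
  have b0 t : 0 <= b t by rewrite mulr_ge0// sqrtr_ge0.
  have yb t j : `|y t j 0| <= b t.
    rewrite [y t]diagonal_coordsK; apply: HI => [|k]; [exact: sqrtr_ge0|exact: coord_le_enorm].
  have k0 : 0 < CI * n%:R + 1 by rewrite ltr_wpDl// mulr_ge0.
  have rk : 0 < r / (CI * n%:R + 1) by rewrite divr_gt0.
  near=> t.
  have br : b t <= r.
    apply: (@le_trans _ _ (CI * (n%:R * (r / (CI * n%:R + 1))))).
      by rewrite ler_wpM2l// enorm_le//; near: t; exact: w_lim.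
    by rewrite !mulrA ler_pdivrMr// mulrC ler_pM2l// lerDl.
  apply: (@le_trans _ _ (CS * (C * b t ^+ 2))).
    apply: HS => [|j]; first by rewrite mulr_ge0// exprn_ge0.
    by apply: HG; [rewrite b0 br|exact: yb].
  rewrite /b exprMn /enorm sqr_sqrtr ?mulrA//.
  by apply: sumr_ge0 => j _; exact: sqr_ge0.
- by move=> i e /w_lim; apply: filterS.
- exact: mulmx_decays.
Unshelve. all: by end_near. Qed.

Section Refinement.
Variable E : set R.
Hypotheses (E_add : forall a b, E a -> E b -> E (a + b)) (E_succ : forall a, E a -> E (a + 1)).

Definition approximable rho := exists2 Y : R -> 'cV[R]_n,
  (forall i, loglog_span E 0 (fun t => Y t i 0)) &
  (forall i, decays rho (fun t => y t i 0 - Y t i 0)).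

(** An approximation of the solution gives a better approximation of the
    nonlinearity; solving the diagonal linear equation formally turns it into a
    better approximation of the solution, by stability. *)
Lemma refine_approx s rho : 0 < s -> s <= rho ->
  (forall i, decays s (fun t => y t i 0)) ->
  (forall r i, exists2 F, loglog_span E 0 F & decays r (fun t => f t i 0 - F t)) ->
  approximable rho -> approximable (rho + s).
Proof.
move=> s0 srho sy f_approx [Y spY yY].
have rs0 : 0 <= rho + s by rewrite addr_ge0// ?(le_trans _ srho)// ltW.
have /choice[H HH] : forall i, exists H, loglog_span E 0 H /\
    decays (rho + s) (fun t => G (y t) i 0 - H t).
  by move=> i; have [H ? ?] := nonlinearity_approx hGm s0 srho E_add sy yY spY i; exists H.
have /choice[F HF] : forall i, exists F, loglog_span E 0 F /\
    decays (rho + s) (fun t => f t i 0 - F t).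
  by move=> i; have [F ? ?] := f_approx (rho + s) i; exists F.
pose Q t : 'cV[R]_n := \col_i (H i t + F i t).
have spQ i : loglog_span E 0 (fun t => Q t i 0).
  under eq_fun do rewrite mxE; exact: LoglogSpanD (HH i).1 (HF i).1.
have dQ i : decays (rho + s) (fun t => (G (y t) + f t - Q t) i 0).
  by apply: decays_eq (decaysD (HH i).2 (HF i).2); near=> t; rewrite !mxE; ring.
have [M HM] : exists M : nat, rho + s < M%:R.
  by exists (Num.truncn (rho + s)).+1; exact: truncnS_gt.
have /choice[W HW] : forall i, exists W, loglog_span E 0 W /\
    decays (rho + s) (fun t => (S *m y t) i 0 - W t).
  move=> i; have := formal_solution M _ E_succ (mulmx_loglog_span S spQ i).
  move=> /(_ (d 0 i))[|W [spW [dW [e [spe DW eqW]]]]]; first by rewrite gt_eqF.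
  exists W; split => //.
  apply: (@stability _ (d 0 i) _ _
    (fun t => - d 0 i * (S *m y t) i 0 + (S *m G (y t)) i 0 + (S *m f t) i 0 - dW t)
    (fun t => (S *m (G (y t) + f t - Q t)) i 0 - e t)) => //.
  - have Dw := is_derive_diagonal i.
    by near=> t; apply: is_deriveB; near: t.
  - near=> t; have -> : dW t = - d 0 i * W t + (S *m Q t) i 0 + e t by near: t.
    have entry (u v w : 'cV[R]_n) : (u + v - w) i 0 = u i 0 + v i 0 - w i 0 by rewrite !mxE.
    by rewrite mulmxBr mulmxDr entry; ring.
  - apply: decaysB; first exact: mulmx_decays.
    by apply: loglog_span_decays spe; rewrite add0r.
exists (fun t => invmx S *m \col_i W i t) => [i|].
  apply: mulmx_loglog_span => j; under eq_fun do rewrite mxE; exact: (HW j).1.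
move=> i; have yW j : decays (rho + s) (fun t => (S *m y t - \col_i W i t) j 0).
  by apply: decays_eq (HW j).2; near=> t; rewrite !mxE.
apply: decays_eq (mulmx_decays (invmx S) yW i); near=> t.
by rewrite mulmxBr -diagonal_coordsK !mxE.
Unshelve. all: by end_near. Qed.

Lemma approximable_all s : 0 < s ->
  (forall i, decays s (fun t => f t i 0)) ->
  (forall r i, exists2 F, loglog_span E 0 F & decays r (fun t => f t i 0 - F t)) ->
  forall rho, approximable rho.
Proof.
move=> s0 fs f_approx.
have sy := solution_decays (ltW s0) fs.
have app k : approximable (k.+1%:R * s).
  elim: k => [|k IHk].
    exists (fun=> 0) => i; first by under eq_fun do rewrite mxE; exact: LoglogSpan0.
    by rewrite mul1r; apply: decays_eq (sy i); near=> t; rewrite mxE subr0.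
  rewrite -natr1 mulrDl mul1r; apply: refine_approx IHk => //.
  by rewrite ler_peMl ?ler1n// ltW.
move=> rho; pose k := Num.truncn (rho / s).
have rk : rho <= k.+1%:R * s by rewrite -ler_pdivrMr// ltW// truncnS_gt.
have [Y spY yY] := app k; exists Y => // i.
exact: decays_weak rk (yY i).
Unshelve. all: by end_near. Qed.

End Refinement.
End Solution.

(** * Vector-valued expansions *)

Section VectorExpansions.
Variables (R : realType) (n : nat) (mu : nat -> R).
Hypothesis mu_incr : forall k l, (k < l)%N -> mu k < mu l.

Lemma mu_unbounded : ~ cvgn mu -> forall r, exists N, r <= mu N.
Proof.
move=> mu_dvg r; apply/not_existsP => H; apply: mu_dvg.
apply: nondecreasing_is_cvgn; first by move=> k l; exact: mu_le.
by exists r => _ [k _ <-]; have /negP := H k; rewrite -ltNge => /ltW.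
Qed.

Lemma loglog_sumE J (q : 'I_J -> 'cV[{poly R}]_n) (g : 'I_J -> R) t i :
  loglog_sum q g t i 0 = \sum_(j < J) loglog_term 0 (g j) (q j i 0) t.
Proof.
rewrite /loglog_sum summxE; apply: eq_bigr => j _.
by rewrite !mxE loglog_term0E powRN.
Qed.

Lemma expansion_approx (f : R -> 'cV[R]_n) (J : nat -> nat)
    (q : forall k, 'I_(J k) -> 'cV[{poly R}]_n) (g : forall k, 'I_(J k) -> R) :
  (forall k j, 0 <= g k j) ->
  asymptotic_expansion f mu (fun k => loglog_sum (@q k) (@g k)) ->
  forall N i, exists2 F, loglog_span (range mu) (mu 0) F &
    decays (mu N) (fun t => f t i 0 - F t).
Proof.
move=> g0 f_exp N i; have [nu munu /bigO_infty_decays/(_ i) dec] := f_exp N.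
exists (fun t => \sum_(k < N.+1) \sum_(j < J k) loglog_term (mu k) (g k j) (q k j i 0) t).
  apply: loglog_span_sum => k _; apply: loglog_span_sum => j _.
  by apply: LoglogSpanTerm; [exists k|exact: mu_le|exact: g0].
apply: decays_eq (decays_weak (ltW munu) dec); near=> t.
rewrite !mxE summxE; congr (_ - _); apply: eq_bigr => k _.
rewrite mxE loglog_sumE mulr_sumr; apply: eq_bigr => j _.
by rewrite loglog_term0E -powRN mulrA.
Unshelve. all: by end_near. Qed.

(** The terms of the coordinates are put side by side, each as a polynomial column
    supported on its own coordinate; a zero term in front keeps the list nonempty. *)
Lemma assemble_expansion (y : R -> 'cV[R]_n) (c : 'I_n -> nat -> seq (R * {poly R})) :
  (forall i, nonneg_exponents (c i)) ->
  (forall i N, expands mu (fun t => y t i 0) N (c i)) ->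
  exists (J : nat -> nat) (q : forall k, 'I_(J k) -> 'cV[{poly R}]_n)
         (gamma : forall k, 'I_(J k) -> R),
    [/\ forall k, (1 <= J k)%N, forall k j, 0 <= gamma k j &
        asymptotic_expansion y mu (fun k => loglog_sum (@q k) (@gamma k))].
Proof.
move=> c0 yc.
pose x0 : R * 'cV[{poly R}]_n := (0, 0).
pose L k := x0 :: [seq (x.1, x.2 *: delta_mx i 0) | i <- index_enum 'I_n, x <- c i k].
exists (fun k => size (L k)), (fun k j => (nth x0 (L k) j).2), (fun k j => (nth x0 (L k) j).1).
split=> [//|k j|].
  have := mem_nth x0 (ltn_ord j); rewrite inE => /predU1P[->//|].
  move=> /allpairsPdep[i [x [_ xc ->]]] /=; exact: (allP (c0 i k)).
have coefE k t i : loglog_sum (fun j : 'I_(size (L k)) => (nth x0 (L k) j).2)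
    (fun j => (nth x0 (L k) j).1) t i 0 = loglog_coef (c i k) t.
  rewrite loglog_sumE.
  rewrite -(big_mkord xpredT (fun j => loglog_term 0 (nth x0 (L k) j).1 ((nth x0 (L k) j).2 i 0) t)).
  rewrite -(big_nth x0 xpredT (fun x => loglog_term 0 x.1 (x.2 i 0) t)) big_cons.
  rewrite big_allpairs_dep (bigD1 i)//= [X in _ + (_ + X)]big1 ?addr0 => [|i' ii'].
    rewrite /= loglog_term0E mxE horner0 mulr0 add0r.
    by apply: eq_bigr => x _; rewrite !mxE !eqxx mulr1.
  by apply: big1 => x _; rewrite loglog_term0E !mxE eq_sym (negbTE ii') mulr0 horner0 mulr0.
move=> N.
have /choice[nu Hnu] : forall i, exists nu, mu N < nu /\
    decays nu (fun t => y t i 0 - partial_sum mu (c i) N t).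
  by move=> i; have [nu ? ?] := yc i N; exists nu.
exists (\big[Order.min/mu N + 1]_(i < n) nu i).
  by apply: lt_bigmin => [|i _]; [rewrite ltrDl|exact: (Hnu i).1].
apply/bigO_infty_decays => i.
apply: decays_weak (bigmin_le _ i nu) _; apply: decays_eq (Hnu i).2; near=> t.
rewrite !mxE summxE; congr (_ - _); apply: eq_bigr => k _.
by rewrite mxE coefE powRN.
Unshelve. all: by end_near. Qed.

End VectorExpansions.
(** * The expansion of the solution *)

Theorem corollary5p10 (R : realType) (n : nat) (hn : (0 < n)%N)
    (A : 'M[R]_n) (hA : diagonalizable_pos A)
    (G : 'cV[R]_n -> 'cV[R]_n) (hG : locally_lipschitz G)
    (Gm : nat -> 'cV[R]_n -> 'cV[R]_n) (hGm : homogeneous_expansion G Gm)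
    (mu : nat -> R)
    (mu_dvg : ~ cvgn mu)
    (mu_incr : forall k l, (k < l)%N -> mu k < mu l)
    (mu_gt0 : forall k, 0 < mu k)
    (mu_add : forall x y, range mu x -> range mu y -> range mu (x + y))
    (mu_succ : forall x, range mu x -> range mu (x + 1))
    (f : R -> 'cV[R]_n) (Tf : R) (hTf : 0 <= Tf)
    (f_cont : {within [set t | 0 < t /\ Tf <= t], continuous f})
    (nk : nat -> nat) (nk_ge1 : forall k, (1 <= nk k)%N)
    (p : forall k, 'I_(nk k) -> 'cV[{poly R}]_n)
    (beta : forall k, 'I_(nk k) -> R)
    (beta_ge0 : forall k j, 0 <= beta k j)
    (f_exp : asymptotic_expansion f mu (fun k => loglog_sum (@p k) (@beta k)))
    (T0 : R) (hT0 : 0 <= T0)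
    (y : R -> 'cV[R]_n) (hy : C1_solution A G f T0 y)
    (y_lim : y t @[t --> +oo] --> (0 : 'cV[R]_n)) :
  exists (J : nat -> nat)
         (q : forall k, 'I_(J k) -> 'cV[{poly R}]_n)
         (gamma : forall k, 'I_(J k) -> R),
    [/\ forall k, (1 <= J k)%N,
        forall k j, 0 <= gamma k j &
        asymptotic_expansion y mu (fun k => loglog_sum (@q k) (@gamma k))].
Proof.
have [S [d [S_unit d_gt0 A_diag]]] := hA.
have mu_cofinal := mu_unbounded mu_incr mu_dvg.
have f_approx := expansion_approx mu_incr beta_ge0 f_exp.
have mu00 := mu_gt0 0%N.
have fs i : decays (mu 0 / 2) (fun t => f t i 0).
  have [F spF dF] := f_approx 0%N i.
  have half : mu 0 / 2 < mu 0 by lra.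
  apply: decays_eq (decaysD (decays_weak (ltW half) dF) (loglog_span_decays half spF)).
  by near=> t; rewrite subrK.
have approx rho : approximable y (range mu) rho.
  apply: (approximable_all S_unit d_gt0 A_diag hGm hy y_lim _ _ _ fs).
  - by move=> a b; exact: mu_add.
  - exact: mu_succ.
  - by rewrite divr_gt0.
  - move=> r i; have [N rN] := mu_cofinal r; have [F spF dF] := f_approx N i.
    exists F; first exact: loglog_span_weak (ltW mu00) spF.
    exact: decays_weak rN dF.
have /choice[c Hc] : forall i, exists c, nonneg_exponents c /\
    forall N, expands mu (fun t => y t i 0) N c.
  move=> i; have [|c c0 yc] := @expands_coherent _ mu mu_incr (fun t => y t i 0); last by exists c.
  move=> N; have [Y spY yY] := approx (mu N.+1).
  have [c c0 Yc] := loglog_span_expands mu_incr N (spY i).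
  by exists c => //; exact: expands_decays mu_incr _ _ _ _ (yY i) Yc.
apply: (@assemble_expansion _ _ mu y c) => i; [exact: (Hc i).1|exact: (Hc i).2].
Unshelve. all: by end_near. Qed.
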